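(* Let $\rho_{AA'B}$ be a tripartite quantum state, and let $\mathbf{E}=\{E^j\}_{j\in\mathcal J}$ be a non-empty finite family of binary-outcome POVMs $E^j=\{E^j_0,E^j_1\}$ acting on $B$. Then $$P_{\mathrm{succ}}(\rho_{AA'B},\mathbf{E})\le 2^{I_{\max}^{\mathrm{acc}}(B;A|A')_\rho}\,P_{\mathrm{succ}}(\rho_{A'B},\mathbf{E}).$$
   Context: All registers are finite-dimensional quantum systems; states are density operators; a subscript denotes the registers, and omitted registers are traced out (e.g. $\rho_{A'B}=\mathrm{tr}_A(\rho_{AA'B})$). A binary-outcome POVM is a pair $\{E_0,E_1\}$ of positive semidefinite operators with $E_0+E_1=\mathrm{id}$. $X\le Y$ means that $Y-X$ is positive semidefinite. For a bipartite state $\rho_{CB}$ and $\mathbf E=\{E^j\}_{j\in\mathcal J}$ as in the claim, $$P_{\mathrm{succ}}(\rho_{CB},\mathbf E):=\max_{\{F_j\}_{j}}\sum_{j\in\mathcal J}\mathrm{tr}\bigl((F_j\otimes E_1^j)\rho_{CB}\bigr),$$ with the maximum over all POVMs $\{F_j\}_{j\in\mathcal J}$ acting on $C$. In the claim this is used with $C=AA'$ and with $C=A'$. A measurement on a register $C$ with outcome register $X$ is a CPTP map $\mathcal M_{C\to X}$ of the form $\mathcal M(\rho_C)=\sum_{x}\mathrm{tr}(M_x\rho_C)\,|x\rangle\langle x|_X$, where $\{M_x\}_x$ is a POVM on $C$ (finite outcome set) and $\{|x\rangle\}$ is a fixed orthonormal basis of $\mathcal H_X$. A map written as acting on some registers acts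 as the identity on the others. $I_{\max}^{\mathrm{acc}}(B;A|A')_\rho$ is the smallest real number such that for every measurement $\mathcal M_{AA'\to X}$ there exists a measurement $\mathcal N_{A'\to X}$ with $\mathcal M(\rho_{AA'B})\le 2^{I_{\max}^{\mathrm{acc}}(B;A|A')_\rho}\,\mathcal N(\rho_{A'B})$. *)

(* Defs.v *)
From mathcomp Require Import all_boot all_order all_algebra.
From mathcomp Require Import all_classical all_reals all_analysis.
From mathcomp Require Import complex mxtens.

Set Implicit Arguments.
Unset Strict Implicit.
Unset Printing Implicit Defensive.

Import Order.TTheory GRing.Theory Num.Theory.
Local Open Scope classical_set_scope.
Local Open Scope ring_scope.
Local Open Scope complex_scope.

(* A d-dimensional register is the Hilbert space R[i]^d with its standard
   basis, and its operators are the d x d matrices over R[i].  The composite of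
   registers of dimensions m and n (in this order) has dimension m * n; its
   basis is indexed through mxtens_index, as for the Kronecker product *t. *)

Section Operators.
Variable R : realType.
Local Notation C := R[i].

(* In the order of R[i], 0 <= z says that z is real and nonnegative; hence an
   operator satisfying psd is Hermitian. *)
Definition psd n (X : 'M[C]_n) : Prop :=
  forall v : 'cV[C]_n, 0 <= (map_mx Num.conj v^T *m X *m v) 0 0.

Definition loewner_le n (X Y : 'M[C]_n) : Prop := psd (Y - X).

Definition state n (rho : 'M[C]_n) : Prop := psd rho /\ \tr rho = 1.

Definition povm (J : finType) n (F : J -> 'M[C]_n) : Prop :=
  (forall j, psd (F j)) /\ \sum_j F j = 1%:M.

Definition ptrace_l m n (X : 'M[C]_(m * n)) : 'M[C]_n :=
  \matrix_(i, j) \sum_k X (mxtens_index (k, i)) (mxtens_index (k, j)).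

(* Phi (x) id on a composite register whose second factor has dimension b: Phi
   is applied to each block (id (x) <k|) X (id (x) |l>).  This is the usual
   tensor product of maps when Phi is linear, as for all the maps used here. *)
Definition tens_id b m n (Phi : 'M[C]_m -> 'M[C]_n) (X : 'M[C]_(m * b)) :
    'M[C]_(n * b) :=
  \matrix_(i, j)
    Phi (\matrix_(p, q) X (mxtens_index (p, (mxtens_unindex i).2))
                          (mxtens_index (q, (mxtens_unindex j).2)))
      (mxtens_unindex i).1 (mxtens_unindex j).1.

Definition measurement m n (Phi : 'M[C]_m -> 'M[C]_n) : Prop :=
  exists2 M : 'I_n -> 'M[C]_m, povm M &
    forall rho, Phi rho = \sum_x \tr (M x *m rho) *: delta_mx x x.

(* E j true and E j false are the elements E^j_1 and E^j_0.  The traces below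
   are real for a state rho and POVMs E j.  The set is then nonempty and
   compact (for a nonempty J), so that its supremum is its maximum. *)
Definition Psucc c b (rho : 'M[C]_(c * b)) (J : finType)
    (E : J -> bool -> 'M[C]_b) : R :=
  sup [set complex.Re (\sum_j \tr ((F j *t E j true) *m rho)) |
        F in [set F : J -> 'M[C]_c | povm F]].

(* Registers are ordered A, A', B.  The exponents admissible for a state rho
   form a nonempty closed set, bounded below by 0 (take traces), so that the
   infimum is the smallest of them. *)
Definition Imax_acc a a' b (rho : 'M[C]_(a * a' * b)) : R :=
  inf [set lambda : R |
    forall n (M : 'M[C]_(a * a') -> 'M[C]_n), measurement M ->
    exists2 N : 'M[C]_a' -> 'M[C]_n, measurement N &
      loewner_le (tens_id M rho)
        ((2 `^ lambda)%:C *: tens_id N (tens_id (@ptrace_l a a') rho))].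

End Operators.

(* Main.v *)
(* Measuring C with a POVM M turns rho_CB into the direct sum over x of the
   operators tr_C((M_x (x) id) rho_CB) on B.  Measuring AA' with the guessing
   POVM itself and using an admissible exponent lambda therefore yields a POVM N
   on A' whose blocks dominate, up to 2^lambda, those of the guess; pairing the
   block j with the positive operator E^j_1 bounds the success probability.
   Passing to the infimum over lambda needs an admissible exponent to exist:
   2^lambda = (dim A)^2 works, with N_x = tr_A(M_x) / dim A, because
   rho <= dim A (1_A (x) tr_A rho). *)
Require Import Defs.
From mathcomp Require Import all_boot all_order all_algebra.
From mathcomp Require Import all_classical all_reals all_analysis.
From mathcomp Require Import complex mxtens spectral ring.

Set Implicit Arguments.
Unset Strict Implicit.
Unset Printing Implicit Defensive.

Import Order.TTheory GRing.Theory Num.Theory.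
Local Open Scope classical_set_scope.
Local Open Scope ring_scope.
Local Open Scope complex_scope.
Local Open Scope sesquilinear_scope.

Section PsdOperators.
Variable R : realType.
Local Notation C := R[i].

(** * The sesquilinear form of an operator *)

(** At [u = v] this is verbatim the expression in [psd], so positivity goals fold into it. *)
Definition sform n (X : 'M[C]_n) (u v : 'cV[C]_n) : C :=
  (map_mx Num.conj u^T *m X *m v) 0 0.

Lemma sformE n (X : 'M[C]_n) u v :
  sform X u v = \sum_i \sum_j Num.conj (u i 0) * X i j * v j 0.
Proof.
rewrite /sform mxE exchange_big; apply: eq_bigr => j _.
by rewrite mxE mulr_suml; apply: eq_bigr => i _; rewrite !mxE.
Qed.

Lemma sformDl n (X : 'M[C]_n) u v w :
  sform X (u + v) w = sform X u w + sform X v w.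
Proof. by rewrite /sform linearD /= map_mxD !mulmxDl mxE. Qed.

Lemma sformDr n (X : 'M[C]_n) u v w :
  sform X u (v + w) = sform X u v + sform X u w.
Proof. by rewrite /sform mulmxDr mxE. Qed.

Lemma sformZl n (X : 'M[C]_n) c u v :
  sform X (c *: u) v = Num.conj c * sform X u v.
Proof. by rewrite /sform linearZ /= map_mxZ -!scalemxAl mxE. Qed.

Lemma sformZr n (X : 'M[C]_n) c u v : sform X u (c *: v) = c * sform X u v.
Proof. by rewrite /sform -scalemxAr mxE. Qed.

Lemma sform_suml n (X : 'M[C]_n) (I : finType) (u : I -> 'cV[C]_n) v :
  sform X (\sum_i u i) v = \sum_i sform X (u i) v.
Proof.
by rewrite /sform linear_sum /= raddf_sum !mulmx_suml summxE.
Qed.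

Lemma sform_sumr n (X : 'M[C]_n) (I : finType) u (v : I -> 'cV[C]_n) :
  sform X u (\sum_i v i) = \sum_i sform X u (v i).
Proof. by rewrite /sform mulmx_sumr summxE. Qed.

Lemma sformDm n (X Y : 'M[C]_n) u v :
  sform (X + Y) u v = sform X u v + sform Y u v.
Proof. by rewrite /sform mulmxDr mulmxDl mxE. Qed.

Lemma sformZm n c (X : 'M[C]_n) u v : sform (c *: X) u v = c * sform X u v.
Proof. by rewrite /sform -scalemxAr -scalemxAl mxE. Qed.

Lemma sformNm n (X : 'M[C]_n) u v : sform (- X) u v = - sform X u v.
Proof. by rewrite -scaleN1r sformZm mulN1r. Qed.

Lemma sform_delta n (X : 'M[C]_n) i j :
  sform X (delta_mx i 0) (delta_mx j 0) = X i j.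
Proof.
by rewrite /sform trmx_delta map_delta_mx -rowE -colE !mxE.
Qed.

(** * Positive semidefinite operators *)

Lemma psdZ n c (X : 'M[C]_n) : 0 <= c -> psd X -> psd (c *: X).
Proof.
by move=> c0 hX v; rewrite -/(sform _ v v) sformZm mulr_ge0 //; exact: hX.
Qed.

Lemma psd0 n : psd (0 : 'M[C]_n).
Proof. by move=> v; rewrite mulmx0 mul0mx mxE. Qed.

Lemma psd1 n : psd (1%:M : 'M[C]_n).
Proof.
move=> v; rewrite mulmx1 mxE; apply: sumr_ge0 => i _.
by rewrite !mxE mulrC mul_conjC_ge0.
Qed.

(** Polarization: the form is real at [u + c *: w], and [c = 1], [c = 'i] control the sum and the
    difference of [X i j] and [X j i]. *)
Lemma psd_hermitian n (X : 'M[C]_n) : psd X -> X \is hermsymmx.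
Proof.
move=> hX; apply/is_hermitianmxP; rewrite expr0 scale1r.
apply/matrixP => i j; rewrite !mxE.
pose u : 'cV[C]_n := delta_mx i 0; pose w : 'cV[C]_n := delta_mx j 0.
have real v : sform X v v \is Num.real by apply/ger0_real; exact: hX.
(* Expanding the form at [u + c *: w] exhibits this cross term as a combination of real numbers. *)
have cross c : Num.conj (c * X i j + Num.conj c * X j i)
    = c * X i j + Num.conj c * X j i.
  apply/CrealP.
  have -> : c * X i j + Num.conj c * X j i
      = sform X (u + c *: w) (u + c *: w) - sform X u u -
        c * Num.conj c * sform X w w.
    rewrite !sformDl !sformDr !sformZl !sformZr !sform_delta.
    set t := Num.conj c; ring.
  have rc : c * Num.conj c \is Num.real by rewrite ger0_real ?mul_conjC_ge0.
  by do 2?[apply: rpredB => //]; apply: rpredM.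
have h1 := cross 1; have hi := cross 'i.
move: h1 hi; rewrite !rmorphD !rmorphM /= !conjCK rmorph1 conjCi !mul1r => h1 hi.
set p := Num.conj (X i j) in h1 hi; set q := Num.conj (X j i) in h1 hi *.
have {}hi : q - p = X i j - X j i.
  apply: (mulfI (neq0Ci C)); rewrite !mulrBr.
  by move: hi; rewrite !mulNr addrC.
apply: (@mulfI _ 2); first by rewrite pnatr_eq0.
have -> : 2 * X i j = (X i j + X j i) + (X i j - X j i) by ring.
by rewrite -h1 -hi; ring.
Qed.

(** Spectral theorem for the Hermitian [X]; each eigenvalue is nonnegative, being the value of the
    form at a unit eigenvector. *)
Lemma psd_spectral n (X : 'M[C]_n) : psd X ->
  exists d : 'I_n -> C, exists u : 'I_n -> 'cV[C]_n,
    (forall k, 0 <= d k) /\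
    forall i j, X i j = \sum_k d k * (u k i 0 * Num.conj (u k j 0)).
Proof.
move=> hX; have /hermitian_normalmx/orthomx_spectralP XE := psd_hermitian hX.
have Punit := spectral_unitarymx X; move: XE Punit.
set P := spectralmx X; set sp := spectral_diag X => XE Punit.
(* [u k] is the k-th column of the adjoint of [P], an eigenvector for [sp 0 k]. *)
pose u k : 'cV[C]_n := (map_mx Num.conj (row k P))^T.
exists (fun k => sp 0 k), u; split=> [k|i j]; last first.
  rewrite {1}XE invmx_unitary // mul_mx_diag mxE; apply: eq_bigr => k _.
  by rewrite !mxE conjCK -mulrA mulrCA.
have := hX (u k); rewrite -[X in _ -> 0 <= X]/(sp 0 k).
have -> : map_mx Num.conj (u k)^T = row k P.
  by apply/matrixP => i j; rewrite !mxE conjCK.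
have -> : u k = P^t* *m delta_mx k 0.
  by rewrite -colE; apply/matrixP => i j; rewrite !mxE.
rewrite {1}XE invmx_unitary // rowE -!mulmxA.
have PP : P *m (P^t* *m delta_mx k 0) = delta_mx k 0 :> 'cV[C]_n.
  by rewrite mulmxA (unitarymxP Punit) mul1mx.
rewrite PP (mulmxA P) (unitarymxP Punit) mul1mx -colE -rowE.
by rewrite !mxE eqxx mulr1n.
Qed.

(** The spectral rank-one terms of [A] turn the trace into a nonnegative combination of values of
    the form of [X]. *)
Lemma psd_trmul_ge0 n (A X : 'M[C]_n) : psd A -> psd X -> 0 <= \tr (A *m X).
Proof.
move=> /psd_spectral[d [u [d0 AE]]] hX.
have -> : \tr (A *m X) = \sum_k d k * sform X (u k) (u k).
  transitivity (\sum_i \sum_j \sum_k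
      d k * (Num.conj (u k j 0) * X j i * u k i 0)).
    rewrite /mxtrace; apply: eq_bigr => i _; rewrite mxE; apply: eq_bigr => j _.
    rewrite AE mulr_suml; apply: eq_bigr => k _; ring.
  under eq_bigr do rewrite exchange_big; rewrite exchange_big /=.
  apply: eq_bigr => k _; rewrite sformE exchange_big mulr_sumr.
  by apply: eq_bigr => i _; rewrite mulr_sumr.
by apply: sumr_ge0 => k _; rewrite mulr_ge0 //; exact: hX.
Qed.

Lemma psd_delta m (i : 'I_m) : psd (delta_mx i i : 'M[C]_m).
Proof.
move=> v; rewrite -/(sform _ v v) sformE (bigD1 i) //= (bigD1 i) //=.
rewrite !big1 ?addr0 => [|k ki|j ji].
- by rewrite mxE !eqxx mulr1 mulrC mul_conjC_ge0.
- by rewrite big1 // => j _; rewrite mxE (negPf ki) mulr0 mul0r.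
- by rewrite mxE (negPf ji) andbF mulr0 mul0r.
Qed.

(** * Weighted partial traces on a composite register *)

Lemma big_mxtens (V : nmodType) m n (f : 'I_(m * n) -> V) :
  \sum_i f i = \sum_p \sum_q f (mxtens_index (p, q)).
Proof.
rewrite pair_bigA (reindex (@mxtens_index m n)) /=; last first.
  exists (@mxtens_unindex m n) => i _; [exact: mxtens_indexK|exact: mxtens_unindexK].
by apply: eq_bigr => -[p q].
Qed.

Definition block m b (X : 'M[C]_(m * b)) (k l : 'I_b) : 'M[C]_m :=
  \matrix_(p, q) X (mxtens_index (p, k)) (mxtens_index (q, l)).

(* [wtrace A X] is the operator tr_C((A (x) id) X) on the second factor. *)
Definition wtrace m b (A : 'M[C]_m) (X : 'M[C]_(m * b)) : 'M[C]_b :=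
  \matrix_(k, l) \tr (A *m block X k l).

Lemma wtraceDr m b (A : 'M[C]_m) (X Y : 'M[C]_(m * b)) :
  wtrace A (X + Y) = wtrace A X + wtrace A Y.
Proof.
apply/matrixP => k l; rewrite !mxE -linearD -mulmxDr /=; congr (\tr (_ *m _)).
by apply/matrixP => p q; rewrite !mxE.
Qed.

Lemma wtraceZr m b c (A : 'M[C]_m) (X : 'M[C]_(m * b)) :
  wtrace A (c *: X) = c *: wtrace A X.
Proof.
apply/matrixP => k l; rewrite !mxE -linearZ /= scalemxAr; congr (\tr (_ *m _)).
by apply/matrixP => p q; rewrite !mxE.
Qed.

Lemma wtraceZl m b c (A : 'M[C]_m) (X : 'M[C]_(m * b)) :
  wtrace (c *: A) X = c *: wtrace A X.
Proof. by apply/matrixP => k l; rewrite !mxE -linearZ /= scalemxAl. Qed.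

Lemma wtrace_suml m b (I : finType) (A : I -> 'M[C]_m) (X : 'M[C]_(m * b)) :
  wtrace (\sum_i A i) X = \sum_i wtrace (A i) X.
Proof.
apply/matrixP => k l; rewrite summxE mxE mulmx_suml raddf_sum.
by apply: eq_bigr => i _; rewrite mxE.
Qed.

(** Isolates the second factor: a guessing term becomes a pairing of [E] with an operator on B,
    where operator inequalities can be used. *)
Lemma mxtrace_tens m b (A : 'M[C]_m) (E : 'M[C]_b) (X : 'M[C]_(m * b)) :
  \tr ((A *t E) *m X) = \tr (E *m wtrace A X).
Proof.
transitivity (\sum_p \sum_k \sum_q \sum_l
   A p q * E k l * X (mxtens_index (q, l)) (mxtens_index (p, k))).
  rewrite /mxtrace big_mxtens; do 2!apply: eq_bigr => ? _.
  rewrite mxE big_mxtens; do 2!apply: eq_bigr => ? _.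
  by rewrite tensmxE.
rewrite exchange_big /mxtrace; apply: eq_bigr => k _; rewrite mxE.
under eq_bigr do rewrite exchange_big; rewrite exchange_big /=.
apply: eq_bigr => l _; rewrite mxE mulr_sumr; apply: eq_bigr => p _.
rewrite mxE mulr_sumr; apply: eq_bigr => q _; rewrite mxE; ring.
Qed.

(** Compressing the second factor of [X] by [v] leaves a positive [Y], and the form to be bounded is
    the trace of [A *m Y]. *)
Lemma psd_wtrace m b (A : 'M[C]_m) (X : 'M[C]_(m * b)) :
  psd A -> psd X -> psd (wtrace A X).
Proof.
move=> hA hX v; rewrite -/(sform _ v v).
pose Y : 'M[C]_m := \matrix_(p, q) sform (\matrix_(k, l)
  X (mxtens_index (p, k)) (mxtens_index (q, l))) v v.
have -> : sform (wtrace A X) v v = \tr (A *m Y).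
  transitivity (\sum_p \sum_q \sum_k \sum_l Num.conj (v k 0) *
     (A p q * X (mxtens_index (q, k)) (mxtens_index (p, l))) * v l 0).
    rewrite sformE; under [RHS]eq_bigr do rewrite exchange_big.
    rewrite [RHS]exchange_big /=; apply: eq_bigr => k _.
    under [RHS]eq_bigr do rewrite exchange_big.
    rewrite [RHS]exchange_big /=; apply: eq_bigr => l _.
    rewrite mxE /mxtrace mulr_sumr mulr_suml; apply: eq_bigr => p _.
    rewrite mxE mulr_sumr mulr_suml; apply: eq_bigr => q _.
    by rewrite mxE.
  rewrite /mxtrace; apply: eq_bigr => p _; rewrite mxE; apply: eq_bigr => q _.
  rewrite mxE sformE mulr_sumr; apply: eq_bigr => k _.
  rewrite mulr_sumr; apply: eq_bigr => l _; rewrite mxE; ring.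
apply: psd_trmul_ge0 => // w.
(* The product vector of [w] and [v]: the form of [X] there is the form of [Y] at [w]. *)
pose wv : 'cV[C]_(m * b) :=
  \col_i (w (mxtens_unindex i).1 0 * v (mxtens_unindex i).2 0).
suff -> : (map_mx Num.conj w^T *m Y *m w) 0 0 = sform X wv wv by exact: hX.
rewrite -/(sform Y w w) !sformE big_mxtens; apply: eq_bigr => p _.
under [RHS]eq_bigr do rewrite big_mxtens.
rewrite [RHS]exchange_big; apply: eq_bigr => q _.
rewrite mxE sformE mulr_sumr mulr_suml; apply: eq_bigr => k _.
rewrite mulr_sumr mulr_suml; apply: eq_bigr => l _.
rewrite !mxE !mxtens_indexK /= rmorphM /=.
set w' := Num.conj (w p 0); set v' := Num.conj (v k 0); ring.
Qed.

(** * The Loewner order between measured operators *)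

(** The form splits over the diagonal blocks; conversely, each block is a weighted trace of [X]
    against a basis projector. *)
Lemma psd_blockdiag n b (D : 'I_n -> 'M[C]_b) (X : 'M[C]_(n * b)) :
  (forall x y k l, X (mxtens_index (x, k)) (mxtens_index (y, l)) =
    if x == y then D x k l else 0) ->
  psd X <-> forall x, psd (D x).
Proof.
move=> XE; split=> [hX x|hD v].
  have -> : D x = wtrace (delta_mx x x) X.
    apply/matrixP => k l; rewrite mxE /mxtrace (bigD1 x) //= mxE (bigD1 x) //=.
    rewrite !mxE !eqxx mul1r XE eqxx !big1 ?addr0 // => [y /negPf yx|y /negPf yx].
      by rewrite mxE big1 // => z _; rewrite !mxE yx mul0r.
    by rewrite !mxE yx andbF mul0r.
  by apply: psd_wtrace => //; exact: psd_delta.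
rewrite -/(sform X v v).
have -> : sform X v v = \sum_x sform (D x)
    (\col_k v (mxtens_index (x, k)) 0) (\col_k v (mxtens_index (x, k)) 0).
  rewrite sformE big_mxtens; apply: eq_bigr => x _.
  rewrite sformE; apply: eq_bigr => k _; rewrite big_mxtens (bigD1 x) //=.
  rewrite [X in _ + X]big1 ?addr0 => [|y /negPf xy].
    by apply: eq_bigr => l _; rewrite XE eqxx !mxE.
  by apply: big1 => l _; rewrite XE eq_sym xy mulr0 mul0r.
by apply: sumr_ge0 => x _; exact: hD.
Qed.

Lemma tens_id_measured m n b (Phi : 'M[C]_m -> 'M[C]_n) (M : 'I_n -> 'M[C]_m)
    (X : 'M[C]_(m * b)) :
  (forall rho, Phi rho = \sum_x \tr (M x *m rho) *: delta_mx x x) ->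
  forall x y k l, tens_id Phi X (mxtens_index (x, k)) (mxtens_index (y, l)) =
    if x == y then wtrace (M x) X k l else 0.
Proof.
move=> PhiE x y k l; rewrite mxE !mxtens_indexK /= PhiE summxE (bigD1 x) //=.
rewrite big1 => [|z /negPf zx]; last by rewrite !mxE eq_sym zx mulr0.
by rewrite !mxE eqxx addr0 [y == x]eq_sym; case: eqP; rewrite ?mulr1 ?mulr0.
Qed.

(** Both sides are block-diagonal in the outcome register, hence so is their difference. *)
Lemma loewner_le_measured m m' n b (Phi : 'M[C]_m -> 'M[C]_n)
    (Psi : 'M[C]_m' -> 'M[C]_n) (M : 'I_n -> 'M[C]_m) (N : 'I_n -> 'M[C]_m')
    (c : C) (X : 'M[C]_(m * b)) (Y : 'M[C]_(m' * b)) :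
  (forall rho, Phi rho = \sum_x \tr (M x *m rho) *: delta_mx x x) ->
  (forall rho, Psi rho = \sum_x \tr (N x *m rho) *: delta_mx x x) ->
  loewner_le (tens_id Phi X) (c *: tens_id Psi Y) <->
  forall x, loewner_le (wtrace (M x) X) (c *: wtrace (N x) Y).
Proof.
move=> PhiE PsiE; apply: psd_blockdiag => x y k l.
have := tens_id_measured X PhiE x y k l; have := tens_id_measured Y PsiE x y k l.
move: (tens_id Phi X) (tens_id Psi Y) => T T' T'E TE.
by rewrite !mxE TE T'E; case: eqP => _; rewrite ?mxE // mulr0 subr0.
Qed.

(** * Tracing out A *)

(** Reassociates indices: the state lives on (AA')B, while splitting off A requires A(A'B). *)
Definition lift_idx a a' b (r : 'I_a) (i : 'I_(a' * b)) : 'I_(a * a' * b) :=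
  mxtens_index (mxtens_index (r, (mxtens_unindex i).1), (mxtens_unindex i).2).

Lemma big_lift_idx (V : nmodType) a a' b (f : 'I_(a * a' * b) -> V) :
  \sum_i f i = \sum_r \sum_i f (@lift_idx a a' b r i).
Proof.
rewrite !big_mxtens; apply: eq_bigr => r _; rewrite big_mxtens.
by do 2!apply: eq_bigr => ? _; rewrite /lift_idx mxtens_indexK.
Qed.

Lemma tens_id_ptraceE a a' b (X : 'M[C]_(a * a' * b)) i j :
  tens_id (@ptrace_l R a a') X i j = \sum_r X (lift_idx r i) (lift_idx r j).
Proof. by rewrite !mxE; apply: eq_bigr => r _; rewrite !mxE. Qed.

(* 1_A (x) Y *)
Definition id_tens a a' b (Y : 'M[C]_(a' * b)) : 'M[C]_(a * a' * b) :=
  \matrix_(i, j)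
    (((mxtens_unindex (mxtens_unindex i).1).1 ==
     (mxtens_unindex (mxtens_unindex j).1).1)%:R *
    Y (mxtens_index ((mxtens_unindex (mxtens_unindex i).1).2,
                     (mxtens_unindex i).2))
      (mxtens_index ((mxtens_unindex (mxtens_unindex j).1).2,
                     (mxtens_unindex j).2))).

Lemma id_tensE a a' b (Y : 'M[C]_(a' * b)) (r s : 'I_a) i j :
  id_tens a Y (lift_idx r i) (lift_idx s j) = (r == s)%:R * Y i j.
Proof.
by rewrite mxE /lift_idx !mxtens_indexK -!surjective_pairing !mxtens_unindexK.
Qed.

(** Partial trace and tensoring with the identity on A are adjoint; this moves [ptrace_l] from a
    POVM element to the state. *)
Lemma wtrace_ptrace a a' b (A : 'M[C]_(a * a')) (Y : 'M[C]_(a' * b)) :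
  wtrace (ptrace_l A) Y = wtrace A (id_tens a Y).
Proof.
apply/matrixP => k l; rewrite !mxE /mxtrace big_mxtens exchange_big.
apply: eq_bigr => p _; rewrite mxE.
under [RHS]eq_bigr do rewrite mxE big_mxtens exchange_big.
rewrite [RHS]exchange_big; apply: eq_bigr => q _.
rewrite !mxE mulr_suml; apply: eq_bigr => r _.
rewrite (bigD1 r) //= big1 ?addr0 => [|s /negPf sr].
  by rewrite !mxE !mxtens_indexK eqxx mul1r.
by rewrite !mxE !mxtens_indexK /= sr mul0r mulr0.
Qed.

Definition lift_vec a a' b (r : 'I_a) (v : 'cV[C]_(a' * b)) :
    'cV[C]_(a * a' * b) :=
  \col_i
    (((mxtens_unindex (mxtens_unindex i).1).1 == r)%:R *
    v (mxtens_index ((mxtens_unindex (mxtens_unindex i).1).2,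
                     (mxtens_unindex i).2)) 0).

Lemma lift_vecE a a' b (r s : 'I_a) (v : 'cV[C]_(a' * b)) i :
  lift_vec r v (lift_idx s i) 0 = (s == r)%:R * v i 0.
Proof.
by rewrite mxE /lift_idx !mxtens_indexK -!surjective_pairing mxtens_unindexK.
Qed.

Lemma sform_lift_vec a a' b (X : 'M[C]_(a * a' * b)) r s u v :
  sform X (lift_vec r u) (lift_vec s v) =
  \sum_i \sum_j Num.conj (u i 0) * X (lift_idx r i) (lift_idx s j) * v j 0.
Proof.
rewrite sformE big_lift_idx (bigD1 r) //= [X in _ + X]big1 ?addr0 => [|t /negPf tr].
  apply: eq_bigr => i _; rewrite big_lift_idx (bigD1 s) //= [X in _ + X]big1 ?addr0.
    by apply: eq_bigr => j _; rewrite !lift_vecE !eqxx !mul1r.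
  by move=> t /negPf ts; apply: big1 => j _; rewrite !lift_vecE ts mul0r mulr0.
apply: big1 => i _; apply: big1 => j _.
by rewrite lift_vecE tr mul0r rmorph0 !mul0r.
Qed.

Lemma sform_ptrace a a' b (X : 'M[C]_(a * a' * b)) v :
  sform (tens_id (@ptrace_l R a a') X) v v =
  \sum_r sform X (lift_vec r v) (lift_vec r v).
Proof.
under eq_bigr do rewrite sform_lift_vec.
rewrite sformE [RHS]exchange_big; apply: eq_bigr => i _.
rewrite [RHS]exchange_big; apply: eq_bigr => j _.
by rewrite tens_id_ptraceE mulr_sumr mulr_suml.
Qed.

Lemma psd_ptrace a a' b (X : 'M[C]_(a * a' * b)) :
  psd X -> psd (tens_id (@ptrace_l R a a') X).
Proof.
move=> hX v; rewrite -/(sform _ v v) sform_ptrace.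
by apply: sumr_ge0 => r _; exact: hX.
Qed.

(** When [f r s] is the form at [w r] and [w s], each summand on the left is the form at
    [w r - w s]. *)
Lemma sum_polarization (K : comPzRingType) a (f : 'I_a -> 'I_a -> K) :
  \sum_r \sum_s (f r r + f s s - (f r s + f s r)) =
  (a%:R * (\sum_r f r r) - \sum_r \sum_s f r s) *+ 2.
Proof.
transitivity (\sum_r (f r r *+ a + \sum_s f s s - (\sum_s f r s + \sum_s f s r))).
  apply: eq_bigr => r _.
  by rewrite big_split sumrN !big_split /= sumr_const card_ord.
rewrite big_split sumrN !big_split /= sumr_const card_ord sumrMnl.
rewrite [X in _ - (_ + X)]exchange_big /= mulr_natl.
by rewrite mulrnBl !mulr2n.
Qed.

Lemma sformB n (X : 'M[C]_n) u v :
  sform X (u - v) (u - v) =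
  sform X u u + sform X v v - (sform X u v + sform X v u).
Proof.
rewrite -[- v]scaleN1r !sformDl !sformDr !sformZl !sformZr rmorphN1.
move: (sform X u u) (sform X u v) (sform X v u) (sform X v v) => x y z t.
ring.
Qed.

(** A Cauchy-Schwarz bound: twice the gap is the sum over all pairs of the form at [w r - w s]. *)
Lemma sform_sum_le n (X : 'M[C]_n) a (w : 'I_a -> 'cV[C]_n) : psd X ->
  sform X (\sum_r w r) (\sum_r w r) <= a%:R * \sum_r sform X (w r) (w r).
Proof.
move=> hX; rewrite sform_suml; under eq_bigr do rewrite sform_sumr.
rewrite -subr_ge0 -(@pmulrn_lge0 _ _ 2) //
  -(sum_polarization (fun r s => sform X (w r) (w s))).
apply: sumr_ge0 => r _; apply: sumr_ge0 => s _.
by rewrite -sformB; exact: hX.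
Qed.

(** Split [w] along the basis of A and apply [sform_sum_le]; each resulting term is one of the
    nonnegative terms that make up the partial trace at [ws s]. *)
Lemma loewner_le_ptrace a a' b (X : 'M[C]_(a * a' * b)) : psd X ->
  loewner_le X (a%:R *: id_tens a (tens_id (@ptrace_l R a a') X)).
Proof.
move=> hX w; rewrite -/(sform _ w w) sformDm sformNm sformZm subr_ge0.
pose ws r : 'cV[C]_(a' * b) := \col_i w (lift_idx r i) 0.
have wE : w = \sum_r lift_vec r (ws r).
  apply/matrixP => i j; rewrite ord1 {j} summxE.
  have [s [{}i ->]] : exists s : 'I_a, exists j, i = lift_idx s j.
    case: (mxtens_indexP i) => p k; case: (mxtens_indexP p) => s t.
    by exists s, (mxtens_index (t, k)); rewrite /lift_idx mxtens_indexK.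
  rewrite (bigD1 s) //= big1 ?addr0 => [|r /negPf rs].
    by rewrite lift_vecE eqxx mul1r mxE.
  by rewrite lift_vecE eq_sym rs mul0r.
rewrite {1 2}wE; apply: le_trans (sform_sum_le _ hX) _.
rewrite ler_wpM2l //.
have -> : sform (id_tens a (tens_id (@ptrace_l R a a') X)) w w =
    \sum_s sform (tens_id (@ptrace_l R a a') X) (ws s) (ws s).
  rewrite sformE big_lift_idx; apply: eq_bigr => s _.
  rewrite sformE; apply: eq_bigr => i _.
  rewrite big_lift_idx (bigD1 s) //= [X in _ + X]big1 ?addr0 => [|r /negPf rs].
    by apply: eq_bigr => j _; rewrite id_tensE eqxx mul1r !mxE.
  by apply: big1 => j _; rewrite id_tensE eq_sym rs mul0r mulr0 mul0r.
apply: ler_sum => s _; rewrite sform_ptrace (bigD1 s) //= lerDl.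
by apply: sumr_ge0 => r _; exact: hX.
Qed.

(** * Reduced POVMs and an admissible factor *)

Lemma ptrace_lE m n (A : 'M[C]_(m * n)) : ptrace_l A = wtrace 1%:M A.
Proof.
apply/matrixP => i j; rewrite !mxE mul1mx; apply: eq_bigr => k _.
by rewrite mxE.
Qed.

Lemma ptrace_l_sum m n (I : finType) (A : I -> 'M[C]_(m * n)) :
  ptrace_l (\sum_x A x) = \sum_x ptrace_l (A x).
Proof.
apply/matrixP => i j; rewrite summxE mxE.
under eq_bigr do rewrite summxE.
by rewrite exchange_big; apply: eq_bigr => x _; rewrite mxE.
Qed.

Lemma ptrace_l1 m n : ptrace_l (1%:M : 'M[C]_(m * n)) = m%:R%:M.
Proof.
apply/matrixP => i j; rewrite !mxE.
under eq_bigr do rewrite mxE (can_eq (@mxtens_indexK _ _)) xpair_eqE eqxx /=.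
by rewrite sumr_const card_ord -mulrnA mulnC mulrnA.
Qed.

Lemma measurement_povm m n (M : 'I_n -> 'M[C]_m) : povm M ->
  measurement (fun X => \sum_x \tr (M x *m X) *: delta_mx x x).
Proof. by exists M. Qed.

Lemma povm_ptrace a a' n (M : 'I_n -> 'M[C]_(a * a')) : (0 < a)%N ->
  povm M -> povm (fun x => a%:R^-1 *: ptrace_l (M x)).
Proof.
move=> a0 [Mpsd Msum]; split=> [x|].
  by apply: psdZ; rewrite ?invr_ge0 // ptrace_lE; apply: psd_wtrace => //; exact: psd1.
rewrite -scaler_sumr -ptrace_l_sum Msum ptrace_l1 scale_scalar_mx mulVf //.
by rewrite pnatr_eq0 -lt0n.
Qed.

(* Discarding A before measuring costs a factor [a] in the pinching bound
   [X <= a (1_A (x) X_A'B)] and another one in normalizing [tr_A (M x)]. *)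
Lemma measured_ptrace_le a a' b (X : 'M[C]_(a * a' * b)) n
    (M : 'M[C]_(a * a') -> 'M[C]_n) : (0 < a)%N -> psd X -> measurement M ->
  exists2 N : 'M[C]_a' -> 'M[C]_n, measurement N &
    loewner_le (tens_id M X)
      ((a * a)%:R *: tens_id N (tens_id (@ptrace_l R a a') X)).
Proof.
move=> a0 hX [P povmP PE].
eexists; first exact: measurement_povm (povm_ptrace a0 povmP).
apply/(loewner_le_measured _ _ _ PE (fun=> erefl)) => x.
rewrite wtraceZl wtrace_ptrace scalerA natrM mulfK ?pnatr_eq0 -?lt0n //.
rewrite /loewner_le -wtraceZr -scaleN1r -wtraceZr -wtraceDr scaleN1r.
by apply: psd_wtrace (loewner_le_ptrace hX); case: povmP.
Qed.

(** * Bounds on success probabilities *)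

(** Stated for one factor [c] and one guess [F], free of suprema, so that it applies at each
    admissible exponent. *)
Lemma psucc_transfer m m' b (X : 'M[C]_(m * b)) (Y : 'M[C]_(m' * b)) (c : C)
    (J : finType) (F : J -> 'M[C]_m) (E : J -> 'M[C]_b) :
  (forall n (M : 'M[C]_m -> 'M[C]_n), measurement M ->
    exists2 N : 'M[C]_m' -> 'M[C]_n, measurement N &
      loewner_le (tens_id M X) (c *: tens_id N Y)) ->
  povm F -> (forall j, psd (E j)) ->
  exists2 G : J -> 'M[C]_m', povm G &
    \sum_j \tr ((F j *t E j) *m X) <= c * \sum_j \tr ((G j *t E j) *m Y).
Proof.
move=> XY [Fpsd Fsum] Epsd.
(* Measurement outcomes are ordinals, so the guesses in [J] are enumerated; [enum_rank] leads back
   to [J]. *)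
pose M (x : 'I_#|J|) := F (enum_val x).
have povmM : povm M.
  split=> [x|]; first exact: Fpsd.
  by rewrite -Fsum (reindex _ (onW_bij _ (@enum_val_bij J))).
have [Psi [N [Npsd Nsum] NE] leXY] := XY _ _ (measurement_povm povmM).
have le x : loewner_le (wtrace (M x) X) (c *: wtrace (N x) Y).
  by move: x; apply/(loewner_le_measured _ _ _ (fun=> erefl) NE).
exists (fun j => N (enum_rank j)).
  split=> [j|]; first exact: Npsd.
  by rewrite -Nsum (reindex _ (onW_bij _ (@enum_rank_bij J))).
rewrite mulr_sumr; apply: ler_sum => j _.
have := psd_trmul_ge0 (Epsd j) (le (enum_rank j)).
rewrite /M enum_rankK mulmxBr -scalemxAr linearB linearZ /= subr_ge0.
by rewrite !mxtrace_tens.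
Qed.

(** Adding the nonnegative [false] terms completes each [E j] to the identity. The bound is
    independent of [G], so the success values are bounded above. *)
Lemma psucc_le_trace m b (Y : 'M[C]_(m * b)) (J : finType)
    (G : J -> 'M[C]_m) (E : J -> bool -> 'M[C]_b) :
  psd Y -> povm G -> (forall j, povm (E j)) ->
  \sum_j \tr ((G j *t E j true) *m Y) <= \tr (ptrace_l Y).
Proof.
move=> hY [Gpsd Gsum] hE.
rewrite ptrace_lE -Gsum wtrace_suml linear_sum /=; apply: ler_sum => j _.
have [Epsd Esum] := hE j; have hW := psd_wtrace (Gpsd j) hY.
rewrite mxtrace_tens -[X in _ <= \tr X]mul1mx -Esum big_bool /= mulmxDl linearD /=.
by rewrite lerDl psd_trmul_ge0.
Qed.

Lemma psucc_ge0 m b (Y : 'M[C]_(m * b)) (J : finType)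
    (G : J -> 'M[C]_m) (E : J -> 'M[C]_b) :
  psd Y -> (forall j, psd (G j)) -> (forall j, psd (E j)) ->
  0 <= \sum_j \tr ((G j *t E j) *m Y).
Proof.
move=> hY hG hE; apply: sumr_ge0 => j _; rewrite mxtrace_tens.
by apply: psd_trmul_ge0 => //; exact: psd_wtrace.
Qed.

Lemma povm_inhabited (J : finType) m : (0 < #|J|)%N ->
  exists F : J -> 'M[C]_m, povm F.
Proof.
case/card_gt0P => j0 _; exists (fun j => if j == j0 then 1%:M else 0).
split=> [j|]; first by case: ifP => _; [exact: psd1 | exact: psd0].
by rewrite (bigD1 j0) //= eqxx big1 ?addr0 // => j /negPf ->.
Qed.

(** * Real parts and base-two logarithms *)

Lemma ler_Re (x y : C) : x <= y -> complex.Re x <= complex.Re y.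
Proof. by rewrite lecE => /andP[]. Qed.

Lemma Re_rmul (c : R) (z : C) : complex.Re (c%:C * z) = c * complex.Re z.
Proof. by case: z => x y /=; rewrite mul0r subr0. Qed.

Lemma powR2_log (x : R) : 0 < x -> 2 `^ (ln x / ln 2) = x.
Proof.
move=> x0; have l2 : (0 : R) < ln 2 by rewrite ln_gt0 // ltr1n.
by rewrite /powR pnatr_eq0 /= mulfVK ?gt_eqF // lnK.
Qed.

Lemma log_le_powR2 (x y : R) : 0 < x -> x <= 2 `^ y -> ln x / ln 2 <= y.
Proof.
move=> x0; have l2 : (0 : R) < ln 2 by rewrite ln_gt0 // ltr1n.
by rewrite ler_pdivrMr // -ln_powR ler_ln ?posrE ?powR_gt0.
Qed.

End PsdOperators.

Theorem theorem2 (R : realType) (a a' b : nat) (rho : 'M[R[i]]_(a * a' * b))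
    (J : finType) (E : J -> bool -> 'M[R[i]]_b) :
  state rho -> (0 < #|J|)%N -> (forall j, povm (E j)) ->
  Psucc rho E
    <= 2 `^ (Imax_acc rho) * Psucc (tens_id (@ptrace_l R a a') rho) E.
Proof.
move=> [rho_psd rho_tr] J0 hE.
have Etrue j : psd (E j true) by case: (hE j).
set rho' := tens_id (@ptrace_l R a a') rho.
have rho'_psd : psd rho' by exact: psd_ptrace.
(* For [a = 0] the trace would be an empty sum, not 1; the reduced POVM divides by [a]. *)
have a0 : (0 < a)%N.
  case: a rho {rho' rho'_psd rho_psd} rho_tr => // rho.
  by rewrite /mxtrace big_lift_idx big_ord0 => /esym/eqP; rewrite oner_eq0.
pose lhs := Psucc rho E; pose rhs := Psucc rho' E.
rewrite -/lhs -/rhs /Imax_acc; set L := (X in inf X).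
(* [sup] of an unbounded set is 0 by convention; boundedness is what places each success value below
   [rhs]. *)
have ubound' : has_ubound [set complex.Re (\sum_j \tr ((F j *t E j true) *m rho'))
    | F in [set F : J -> 'M[R[i]]_a' | povm F]].
  exists (complex.Re (\tr (ptrace_l rho'))) => _ [G hG <-].
  by apply: ler_Re; exact: psucc_le_trace.
have lhs_le lambda : L lambda -> lhs <= 2 `^ lambda * rhs.
  move=> hL; apply: ge_sup.
    have [F hF] := @povm_inhabited R J (a * a') J0.
    by exists (complex.Re (\sum_j \tr ((F j *t E j true) *m rho))), F.
  move=> _ [F hF <-]; have [G hG le] := psucc_transfer hL hF Etrue.
  apply: le_trans (ler_Re le) _; rewrite Re_rmul ler_wpM2l ?powR_ge0 //.
  by apply: ub_le_sup => //; exists G.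
have rhs_ge0 : 0 <= rhs.
  have [G hG] := @povm_inhabited R J a' J0.
  apply: le_trans (ub_le_sup ubound' (ex_intro2 _ _ G hG erefl)).
  by apply: (@ler_Re _ 0); apply: psucc_ge0 => //; case: hG.
(* [inf] of the empty set is 0 by convention. The witness is the base-two logarithm of [a * a]. *)
have L0 : nonempty L.
  exists (ln (a * a)%:R / ln 2) => n M hM.
  rewrite powR2_log ?ltr0n ?muln_gt0 ?a0 // rmorph_nat.
  exact: measured_ptrace_le.
(* If [lhs] is positive, any admissible exponent forces [rhs] to be positive, and the quotient has a
   logarithm. *)
have [lhs0|lhs0] := leP lhs 0.
  by apply: le_trans lhs0 _; rewrite mulr_ge0 ?powR_ge0.
have rhs0 : 0 < rhs.
  have [l hl] := L0; have := lt_le_trans lhs0 (lhs_le _ hl).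
  by rewrite pmulr_rgt0 // powR_gt0.
have q0 : 0 < lhs / rhs by exact: divr_gt0.
(* The infimum is compared through a lower bound: by [lhs_le], the base-two logarithm of [lhs / rhs]
   is below every admissible exponent. *)
rewrite -ler_pdivrMr // -[leLHS]powR2_log //.
apply: ler_powR; first by rewrite ler1n.
apply: lb_le_inf => // lambda /lhs_le hl.
by apply: log_le_powR2; rewrite ?ler_pdivrMr.
Qed.
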